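(* Let $f\colon\mathbb{R}\to\mathbb{C}$ be a quasisymmetric embedding. The following conditions are equivalent. (i) $f$ is asymptotically symmetric (AS). (ii) $f$ is weakly asymptotically symmetric (WAS). (iii) The distortion of $f$ on symmetric triples tends uniformly to $1$ as the scale tends to $0$, i.e. $f$ is equidistant weakly asymptotically symmetric (EWAS): $H_f^{\mathrm{eq}}(r)\to 1$ as $r\to 0$.
   Context: Let $X,Y$ be metric spaces with distances written $|x_1-x_2|$; $\mathbb{R}$ and $\mathbb{C}$ carry the Euclidean metric. An embedding $h\colon X\to Y$ (homeomorphism onto its image) is quasisymmetric if there is a homeomorphism $\eta\colon[0,\infty)\to[0,\infty)$ such that for any three distinct points $a,b,x\in X$ and $t\ge 0$, $\frac{|a-x|}{|b-x|}\le t$ implies $\frac{|h(a)-h(x)|}{|h(b)-h(x)|}\le\eta(t)$. $h$ is asymptotically symmetric (AS) if for every $\varepsilon>0$ and every $t>0$ there exists $\delta>0$ such that for all distinct $a,b,x\in X$ with $\operatorname{diam}\{a,b,x\}\le\delta$: $\frac{|a-x|}{|b-x|}\le t$ implies $\frac{|h(a)-h(x)|}{|h(b)-h(x)|}\le(1+\varepsilon)t$. $h$ is weakly asymptotically symmetric (WAS) if this is required only for $t=1$ (for every $\varepsilon>0$). For $r>0$ put $$H_h^{\mathrm{eq}}(r)=\sup\left\{\max\left(\tfrac{|h(a)-h(x)|}{|h(b)-h(x)|},\tfrac{|h(b)-h(x)|}{|h(a)-h(x)|}\right): a,b,x\in X,\ |a-x|=|b-x|,\ 0<\operatorname{diam}\{a,b,x\}\le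 r\right\}.$$ $h$ is equidistant weakly asymptotically symmetric (EWAS) if $H_h^{\mathrm{eq}}(r)\to1$ as $r\to0$. *)

(* Defs.v *)
From HB Require Import structures.
From mathcomp Require Import all_boot all_order all_algebra.
From mathcomp Require Import all_classical all_reals.
From mathcomp Require Import ereal topology normedtype.
From mathcomp Require Import complex.

Set Implicit Arguments.
Unset Strict Implicit.
Unset Printing Implicit Defensive.

Import Order.TTheory GRing.Theory Num.Theory.
Import numFieldNormedType.Exports.

Local Open Scope classical_set_scope.
Local Open Scope ring_scope.

(* The norm of [Rcomplex R] (unlike that of [R[i]]) takes its values in [R]:
   it is the Euclidean norm Num.sqrt (a ^+ 2 + b ^+ 2).  The real line as a
   [metricType], with distance `|y - x|, is the copy [R^o] of [R]. *)
Section Rcomplex_metric.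
Variable R : rcfType.

Definition Rcomplex_dist (z w : Rcomplex R) : R := `|z - w|.

Let distxx z : Rcomplex_dist z z = 0.
Proof. by rewrite /Rcomplex_dist subrr normr0. Qed.

Let dist_positivity z w : Rcomplex_dist z w = 0 -> z = w.
Proof. by move/eqP; rewrite normr_eq0 subr_eq0 => /eqP. Qed.

Let dist_sym z w : Rcomplex_dist z w = Rcomplex_dist w z.
Proof. exact: distrC. Qed.

Let dist_triangle w z v :
  Rcomplex_dist z v <= Rcomplex_dist z w + Rcomplex_dist w v.
Proof. exact: ler_distD. Qed.

HB.instance Definition _ := @isMetric.Build R (Rcomplex R)
  Rcomplex_dist distxx dist_positivity dist_sym dist_triangle.

End Rcomplex_metric.

(* Both sets carry the subspace topology; only the values of [h] on [A]
   matter. *)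
Definition homeomorphism_between (T U : topologicalType)
    (A : set T) (B : set U) (h : T -> U) : Prop :=
  exists g : U -> T,
    [/\ set_bij A B h, {in A, cancel h g},
        {within A, continuous h} & {within B, continuous g}].

Definition embedding (T U : topologicalType) (h : T -> U) : Prop :=
  homeomorphism_between [set: T] (range h) h.

Section Distortion.
Variables (R : realType) (X Y : metricType R).
Implicit Types (h : X -> Y) (a b x : X).

Definition diam (A : set X) : \bar R :=
  ereal_sup [set (mdist p.1 p.2)%:E | p in A `*` A].

Definition ratio h a b x : R := mdist (h a) (h x) / mdist (h b) (h x).

Definition quasisymmetric h : Prop :=
  embedding h /\
  exists eta : R -> R,
    @homeomorphism_between R R `[0, +oo[ `[0, +oo[ eta /\
    forall a b x, a != b -> a != x -> b != x -> forall t : R, 0 <= t ->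
      mdist a x / mdist b x <= t -> ratio h a b x <= eta t.

Definition asymptotically_symmetric_at h (t : R) : Prop :=
  forall eps : R, 0 < eps -> exists2 delta : R, 0 < delta &
    forall a b x, a != b -> a != x -> b != x ->
      (diam [set a; b; x] <= delta%:E)%E ->
      mdist a x / mdist b x <= t -> ratio h a b x <= (1 + eps) * t.

Definition asymptotically_symmetric h : Prop :=
  forall t : R, 0 < t -> asymptotically_symmetric_at h t.

Definition weakly_asymptotically_symmetric h : Prop :=
  asymptotically_symmetric_at h 1.

Definition Heq h (r : R) : \bar R :=
  ereal_sup [set u : \bar R | exists a b x,
    [/\ mdist a x = mdist b x,
        (0 < diam [set a; b; x] <= r%:E)%E &
        u = (Num.max (ratio h a b x) (ratio h b a x))%:E]].

Definition equidistant_weakly_asymptotically_symmetric h : Prop :=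
  Heq h r @[r --> 0^'+] --> 1%E.

End Distortion.

(* Main.v *)
(** The only substantial implication is EWAS => AS.  If AS fails for some [t],
    rescaling [f] near bad triples of vanishing size gives normalised embeddings
    with common quasisymmetry bounds, and their pointwise limit [g] along an
    ultrafilter satisfies |g(x + s) - g(x)| = |g(x - s) - g(x)| for all [x] and
    [s].  It suffices that such a [g] is the standard line.

    Restrict [g] to an arithmetic progression and let [r n], of modulus 1, be the
    ratio of the consecutive steps [n + 1] and [n].  The hypothesis for [s] equal
    to 2 and 3 steps makes Re (r n) 2-periodic and Im (r n) Im (r n.+1)
    3-periodic, and a short case analysis shows that [r] is 12-periodic.  Hence
    advancing by 12 multiplies the steps by a constant [zeta] of modulus 1.  If
    [zeta <> 1] the image of the progression is bounded, which contradicts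
    quasisymmetry; so [zeta = 1], and every point of [g] is the midpoint of the
    points 12 steps before and after it.  As the step is arbitrary, [g] is
    additive, and being locally bounded it is linear. *)

Require Import Defs.
From mathcomp Require Import all_boot all_order all_algebra.
From mathcomp Require Import all_classical all_reals.
From mathcomp Require Import ereal topology normedtype realfun.
From mathcomp Require Import complex.
From mathcomp Require Import ring lra zify.

Set Implicit Arguments.
Unset Strict Implicit.
Unset Printing Implicit Defensive.

Import Order.TTheory GRing.Theory Num.Theory.
Import numFieldNormedType.Exports.

Local Open Scope classical_set_scope.
Local Open Scope ring_scope.

(** * Turns of equidistant sequences *)

Section Equidistant_sequences.
Variable C : numClosedFieldType.
Implicit Types (h : nat -> C) (n k : nat).

Definition equidistant h : Prop :=
  forall k n, `|h (n + k + k)%N - h (n + k)%N| = `|h (n + k)%N - h n|.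

Definition turn h n : C := (h n.+2 - h n.+1) / (h n.+1 - h n).

(** For [z] of modulus 1 this is 2i times the imaginary part, while [z + z^-1] is twice the real
    part. *)
Definition skew (z : C) := z - z^-1.

Lemma equidistant_subseq m c h :
  equidistant h -> equidistant (fun n => h (m * n + c)%N).
Proof.
move=> eh k n; have := eh (m * k)%N (m * n + c)%N.
rewrite [in (_ * (n + k + k))%N]mulnDr [in (_ * (n + k))%N]mulnDr.
by rewrite 2![(_ + m * k + c)%N]addnAC.
Qed.

Lemma injective_subseq m c h : (0 < m)%N ->
  injective h -> injective (fun n => h (m * n + c)%N).
Proof. by move=> m0 ih i j /ih; nia. Qed.

Lemma norm1_conj (z : C) : `|z| = 1 -> z^* = z^-1.
Proof.
move=> z1; have z0 : z != 0 by rewrite -normr_eq0 z1 oner_eq0.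
by apply: (mulfI z0); rewrite -normCK z1 expr1n divff.
Qed.

Lemma norm_sq_add1 (z : C) : `|z| = 1 -> `|1 + z| ^+ 2 = 2 + (z + z^-1).
Proof.
move=> z1; have z0 : z != 0 by rewrite -normr_eq0 z1 oner_eq0.
have -> : `|1 + z| ^+ 2 = (1 + z) * (1 + z^-1).
  by rewrite normCK rmorphD /= conjC1 norm1_conj.
by field.
Qed.

Lemma norm_sq_add1M (z w : C) : `|z| = 1 -> `|w| = 1 ->
  `|1 + z + z * w| ^+ 2 =
  3 + (z + z^-1) + (w + w^-1) + (z * w + (z * w)^-1).
Proof.
move=> z1 w1; have z0 : z != 0 by rewrite -normr_eq0 z1 oner_eq0.
have w0 : w != 0 by rewrite -normr_eq0 w1 oner_eq0.
have -> : `|1 + z + z * w| ^+ 2 = (1 + z + z * w) * (1 + z^-1 + z^-1 * w^-1).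
  by rewrite normCK !rmorphD /= conjC1 rmorphM /= !norm1_conj.
by field; rewrite z0 w0.
Qed.

Section Turns.
Variable h : nat -> C.
Hypotheses (h_inj : injective h) (h_eq : equidistant h).
Local Notation r := (turn h).

Let step_neq0 n : h n.+1 - h n != 0.
Proof. by rewrite subr_eq0; apply/eqP => /h_inj; lia. Qed.

Lemma turn_norm n : `|r n| = 1.
Proof.
have := h_eq 1 n; rewrite !addn1 /turn normf_div => ->.
by rewrite divff // normr_eq0 step_neq0.
Qed.

Lemma turn_neq0 n : r n != 0.
Proof. by rewrite -normr_eq0 turn_norm oner_eq0. Qed.

Lemma turn_neqN1 n : r n != -1.
Proof.
apply/eqP => /(congr1 (fun z => z * (h n.+1 - h n))).
rewrite /turn mulfVK ?step_neq0 // mulN1r opprB => /addIr /h_inj; lia.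
Qed.

Lemma step_turn n : h n.+2 - h n.+1 = r n * (h n.+1 - h n).
Proof. by rewrite /turn mulfVK ?step_neq0. Qed.


Let normuS n : `|h n.+2 - h n.+1| = `|h n.+1 - h n|.
Proof. by rewrite step_turn normrM turn_norm mul1r. Qed.

(** All steps have the same length, so a chord over two steps depends only on the real part of the
    turn between them. Equidistance with [k = 2] equates the chords at [n] and [n.+2]. *)
Lemma turn_sum_periodic n : r n.+2 + (r n.+2)^-1 = r n + (r n)^-1.
Proof.
have chord k : `|h k.+2 - h k| ^+ 2 =
    (2 + (r k + (r k)^-1)) * `|h k.+1 - h k| ^+ 2.
  rewrite -norm_sq_add1 ?turn_norm // -exprMn -normrM mulrDl mul1r -step_turn.
  by rewrite [in RHS]addrC subrKA.
have /(congr1 (fun z => z ^+ 2)) := h_eq 2 n.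
rewrite !addnS !addn0 !chord !normuS => /mulIf H; apply/(addrI 2)/H.
by rewrite expf_neq0 // normr_eq0 step_neq0.
Qed.

(** Chords over three steps are compared at [n] and [n.+3]. The terms coming from the single turns
    cancel, since by [turn_sum_periodic] they are merely swapped. *)
Lemma turn_prod_periodic n :
  r n.+3 * r n.+4 + (r n.+3 * r n.+4)^-1 = r n * r n.+1 + (r n * r n.+1)^-1.
Proof.
have chord k : `|h k.+3 - h k| ^+ 2 =
    (3 + (r k + (r k)^-1) + (r k.+1 + (r k.+1)^-1) +
     (r k * r k.+1 + (r k * r k.+1)^-1)) * `|h k.+1 - h k| ^+ 2.
  rewrite -norm_sq_add1M ?turn_norm // -exprMn -normrM; congr (`|_| ^+ 2).
  rewrite -(subrKA (h k.+2)) -(subrKA (h k.+1) (h k.+2)) !step_turn.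
  by ring.
have /(congr1 (fun z => z ^+ 2)) := h_eq 3 n.
rewrite !addnS !addn0 !chord !normuS => /mulIf H.
have {}H := H _; move: H; rewrite expf_neq0 ?normr_eq0 ?step_neq0 // => /(_ isT).
rewrite (turn_sum_periodic n.+2) (turn_sum_periodic n) (turn_sum_periodic n.+1).
rewrite [3 + (r n.+1 + _) + _]addrAC => H.
exact: addrI H.
Qed.

Lemma turn_skew_sq_periodic n : skew (r n.+2) ^+ 2 = skew (r n) ^+ 2.
Proof.
have sq z : z != 0 -> skew z ^+ 2 = (z + z^-1) ^+ 2 - 4.
  by move=> z0; rewrite /skew; field.
by rewrite !sq ?turn_neq0 // turn_sum_periodic.
Qed.

(** The addition formula for the cosine expresses a product of sines by the cosines of the two
    angles and of their sum. *)
Lemma turn_skew_mul_periodic n :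
  skew (r n.+3) * skew (r n.+4) = skew (r n) * skew (r n.+1).
Proof.
have mul z w : z != 0 -> w != 0 ->
    skew z * skew w = 2 * (z * w + (z * w)^-1) - (z + z^-1) * (w + w^-1).
  by move=> z0 w0; rewrite /skew; field; rewrite z0 w0.
rewrite !mul ?turn_neq0 // turn_prod_periodic.
rewrite (turn_sum_periodic n.+2) (turn_sum_periodic n.+1) (turn_sum_periodic n).
by rewrite [(r n.+1 + _) * _]mulrC.
Qed.

(** The other root of [z = z^-1] is -1, at which the sequence would return to [h n]. *)
Lemma skew_turn_eq0 n : skew (r n) = 0 -> r n = 1.
Proof.
move=> /eqP; rewrite subr_eq0 => /eqP r1.
have /eqP : (r n) ^+ 2 = 1 by rewrite expr2 {2}r1 divff ?turn_neq0.
by rewrite sqrf_eq1 (negPf (turn_neqN1 n)) orbF => /eqP.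
Qed.

(* The quotients [skew (r n.+3) / skew (r n)] are alternately inverse to each
   other, hence the period 6. *)
Lemma turn_periodic_nondegenerate :
  (forall n, skew (r n) != 0) -> forall n, r (n + 6)%N = r n.
Proof.
move=> s0 n.
have sum6 : r (n + 6)%N + (r (n + 6)%N)^-1 = r n + (r n)^-1.
  by rewrite !addnS addn0 !turn_sum_periodic.
have skew6 : skew (r (n + 6)%N) = skew (r n).
  have e0 := turn_skew_mul_periodic n.
  have e1 := turn_skew_mul_periodic n.+1.
  have e2 := turn_skew_mul_periodic n.+2.
  rewrite !addnS addn0.
  apply: (mulfI (s0 n.+3)); apply: (mulfI (s0 n.+4)); apply: (mulfI (s0 (n.+4.+1))).
  transitivity (skew (r n.+3) * skew (r n.+4) *
                (skew (r (n.+4.+1)) * skew (r (n.+4.+2)))); first by ring.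
  rewrite e0 e2; transitivity (skew (r n) * skew (r n.+3) *
                (skew (r n.+1) * skew (r n.+2))); first by ring.
  by rewrite -e1; ring.
apply: (@mulfI _ 2); first by rewrite pnatr_eq0.
have dbl z : 2 * z = skew z + (z + z^-1) by rewrite /skew; ring.
by rewrite !dbl skew6 sum6.
Qed.

End Turns.

(** * Period 12 and the midpoint property *)

Section Rigidity.
Variable h : nat -> C.
Hypotheses (h_inj : injective h) (h_eq : equidistant h).
Local Notation r := (turn h).

Lemma skew_turn_parity k n : (skew (r (n + k.*2)%N) == 0) = (skew (r n) == 0).
Proof.
elim: k => [|k IH]; first by rewrite addn0.
rewrite -IH doubleS !addnS -[LHS](@expf_eq0 _ _ 2) -[RHS](@expf_eq0 _ _ 2).
by rewrite turn_skew_sq_periodic.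
Qed.

(* If every other turn is trivial, the remaining points form an equidistant
   sequence whose turns are exactly the nontrivial ones. *)
Lemma turn_periodic_half_flat c n :
  skew (r c) = 0 -> r (n + c + 12)%N = r (n + c)%N.
Proof.
move=> rc0.
have flat k : r (c + k.*2)%N = 1.
  by apply: skew_turn_eq0 => //; apply/eqP; rewrite skew_turn_parity rc0.
have [/eqP rc1|rc1] := boolP (skew (r c.+1) == 0).
  have flatS k : r (c.+1 + k.*2)%N = 1.
    by apply: skew_turn_eq0 => //; apply/eqP; rewrite skew_turn_parity rc1.
  have all1 m : r (m + c)%N = 1.
    rewrite -(odd_double_half m); case: odd.
      by rewrite -(flatS m./2); congr r; lia.
    by rewrite -(flat m./2); congr r; lia.
  by rewrite addnAC !all1.
pose h' k := h (2 * k + c)%N.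
have h'_inj : injective h' by apply: injective_subseq.
have h'_eq : equidistant h' by apply: equidistant_subseq.
have turn' k : turn h' k = r (c.+1 + k.*2)%N.
  (* The two steps around a flat turn are equal, so each step of [h'] is twice a step of [h]. *)
  have step k' : h' k'.+1 - h' k' = 2 * (h (c + k'.*2).+1%N - h (c + k'.*2)%N).
    rewrite /h' (_ : 2 * k'.+1 + c = (c + k'.*2).+2)%N; last lia.
    rewrite (_ : 2 * k' + c = c + k'.*2)%N; last lia.
    rewrite -(subrKA (h (c + k'.*2).+1)) step_turn // flat mul1r.
    by rewrite -mulr2n mulr_natl.
  rewrite /turn !step addSn doubleS !addnS -mulf_div divff ?pnatr_eq0 // mul1r.
  rewrite /turn; congr (_ / _).
  by rewrite step_turn // flat mul1r.
have per := @turn_periodic_nondegenerate h' h'_inj h'_eq _.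
(* Six turns of [h'] span twelve turns of [h]. *)
have {}per k : r (c.+1 + k.*2 + 12)%N = r (c.+1 + k.*2)%N.
  rewrite -turn' -per; last by move=> m; rewrite turn' skew_turn_parity.
  by rewrite turn'; congr r; lia.
rewrite -(odd_double_half n); case: odd.
  have := per n./2; rewrite (_ : (_ + _ + 12 = true + n./2.*2 + c + 12))%N; last lia.
  by move=> ->; congr r; lia.
rewrite (_ : false + n./2.*2 + c + 12 = c + (n./2 + 6).*2)%N; last lia.
by rewrite (_ : false + n./2.*2 + c = c + n./2.*2)%N ?flat //; lia.
Qed.

(* When the flat turns have odd index, nothing controls the turn at 0. *)
Lemma turn_periodic n : r (n.+1 + 12)%N = r n.+1.
Proof.
have [/eqP r0|r0] := boolP (skew (r 0) == 0).
  by have := turn_periodic_half_flat n.+1 r0; rewrite addn0.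
have [/eqP r1|r1] := boolP (skew (r 1) == 0).
  by have := turn_periodic_half_flat n r1; rewrite addn1.
have nz m : skew (r m) != 0.
  by rewrite -(odd_double_half m); case: odd; rewrite skew_turn_parity.
by rewrite -[12%N]/(6 + 6)%N addnA !turn_periodic_nondegenerate.
Qed.

(* By periodicity of the turns, advancing by 12 steps multiplies the steps by
   a constant; unless this constant is 1, a geometric sum bounds [h]. *)
Lemma unbounded_equidistant_midpoint :
  (forall M : C, 0 <= M ->
     exists m, forall n, (m <= n)%N -> M < `|h n - h 1|) ->
  h 25 - h 13 = h 13 - h 1.
Proof.
move=> h_unb.
(* The base point is [h 1] because [turn_periodic] does not cover the turn at 0. *)
pose zeta := (h 14 - h 13) / (h 2 - h 1).
have u0 n : h n.+1 - h n != 0 by rewrite subr_eq0; apply/eqP => /h_inj; lia.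
have stepM n : h (n + 14)%N - h (n + 13)%N = zeta * (h n.+2 - h n.+1).
  elim: n => [|n IH]; first by rewrite /zeta mulfVK.
  rewrite !addSn !addnS addn0.
  rewrite !addnS addn0 in IH.
  rewrite step_turn // IH [in RHS]step_turn // mulrCA; congr (_ * (_ * _)).
  by rewrite -(turn_periodic n); congr r; lia.
have advM i n : h (n + i + 13)%N - h (n + 13)%N = zeta * (h (n + i).+1 - h n.+1).
  elim: i => [|i IH]; first by rewrite !addn0 !subrr mulr0.
  rewrite -(subrKA (h (n + i + 13)%N)) IH.
  rewrite (_ : n + i.+1 + 13 = n + i + 14)%N; last lia.
  by rewrite stepM -mulrDr addnS subrKA.
have zeta1 : `|zeta| = 1.
  have tn k : `|h k.+2 - h k.+1| = `|h k.+1 - h k|.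
    by rewrite step_turn // normrM turn_norm // mul1r.
  by rewrite /zeta normf_div !tn divff // normr_eq0 u0.
pose V := h 13 - h 1.
have geom k : (1 - zeta) * (h (12 * k).+1 - h 1) = (1 - zeta ^+ k) * V.
  elim: k => [|k IH]; first by rewrite muln0 subrr mulr0 expr0 subrr mul0r.
  have := advM (12 * k)%N 0%N; rewrite !add0n => a.
  rewrite (_ : (12 * k.+1).+1 = 12 * k + 13)%N; last lia.
  by rewrite -(subrKA (h 13) (h _)) a mulrDr mulrCA IH /V exprS; ring.
have [zeta_eq1|zeta_neq1] := eqVneq zeta 1.
  by have := advM 12%N 0%N; rewrite zeta_eq1 mul1r.
(* Since [|1 - zeta ^+ k| <= 2], [geom] keeps every [h (12 * k).+1] within [M] of [h 1]. *)
pose M := 2 * `|V| / `|1 - zeta|.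
have nz : 0 < `|1 - zeta| by rewrite normr_gt0 subr_eq0 eq_sym.
have [|m hm] := h_unb M; first by rewrite /M divr_ge0 ?mulr_ge0.
have := hm (12 * m).+1; rewrite ltr_pdivrMr // => bad.
have : 2 * `|V| < `|1 - zeta ^+ m| * `|V|.
  by rewrite -normrM -geom normrM [ltRHS]mulrC; apply: bad; lia.
suff /ler_wpM2r - /(_ `|V| (normr_ge0 _)) le2 : `|1 - zeta ^+ m| <= 2.
  by move=> /lt_le_trans /(_ le2); rewrite ltxx.
by rewrite (le_trans (ler_normB _ _)) // normrX zeta1 expr1n normr1.
Qed.

End Rigidity.
End Equidistant_sequences.

(** * Balanced maps of the line into the plane *)

Section Distortion_bounds.
Variable R : realType.
Implicit Types (g : R -> Rcomplex R) (a b x s t c : R).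

(** Free of quotients and of distinctness conditions, so that it passes to pointwise limits. *)
Definition distortion_le t c g : Prop := forall a b x,
  `|a - x| <= t * `|b - x| -> `|g a - g x| <= c * `|g b - g x|.

Definition balanced g : Prop :=
  forall x s, `|g (x + s) - g x| = `|g (x - s) - g x|.

Lemma complex_norm_Rcomplex (z : Rcomplex R) :
  `|z : R[i]| = (`|z|)%:C%C.
Proof. by []. Qed.

Lemma norm_RcomplexM (z w : Rcomplex R) : `|z * w : Rcomplex R| = `|z| * `|w| :> R.
Proof. exact: ComplexField.Normc.normcM. Qed.

Lemma norm_RcomplexV (z : Rcomplex R) : `|z^-1 : Rcomplex R| = `|z|^-1 :> R.
Proof. exact: ComplexField.Normc.normcV. Qed.

Lemma norm_real_Rcomplex x : `|x%:C%C : Rcomplex R| = `|x| :> R.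
Proof.
by rewrite /Num.norm /= expr0n addr0 sqrtr_sqr.
Qed.

Lemma balanced_midpoint g : injective g -> balanced g ->
  (forall c, 0 < c -> exists2 t, 0 < t & distortion_le t c g) ->
  forall x s, g (x + s) - g x = g x - g (x - s).
Proof.
move=> g_inj g_bal g_dist x s.
have [->|s0] := eqVneq s 0; first by rewrite addr0 subr0 subrr.
(* With this spacing [h 1], [h 13] and [h 25] are the values at [x - s], [x] and [x + s]. *)
pose d := s / 12.
have d0 : d != 0 by rewrite /d mulf_neq0 ?invr_neq0 ?pnatr_eq0.
pose h n : R[i] := g (x + (n%:R - 13) * d).
have h_inj : injective h.
  by move=> i j /g_inj /addrI /(mulIf d0) /addIr /eqP; rewrite eqr_nat => /eqP.
have h_eq : equidistant h.
  move=> k n; rewrite !complex_norm_Rcomplex; congr (_%:C)%C.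
  have := g_bal (x + ((n + k)%:R - 13) * d) (k%:R * d).
  rewrite [in RHS]distrC /h => bal.
  rewrite (_ : x + ((n + k + k)%:R - 13) * d =
    x + ((n + k)%:R - 13) * d + k%:R * d); last by rewrite !natrD; ring.
  rewrite (_ : x + (n%:R - 13) * d =
    x + ((n + k)%:R - 13) * d - k%:R * d); last by rewrite !natrD; ring.
  exact: bal.
have h_unb (M : R[i]) : 0 <= M -> exists m, forall n, (m <= n)%N -> M < `|h n - h 1|.
  (* In the order of [R[i]], [0 <= M] forces [M] to be real. *)
  case: M => K K'; rewrite lecE /= => /andP[/eqP -> K0].
  pose A := `|h 2 - h 1 : Rcomplex R|.
  have A0 : 0 < A by rewrite normr_gt0 subr_eq0; apply/eqP => /h_inj.
  (* Once [t * (n - 1) >= 1], the first step, of length [A], is at most [A / (K + 1)] times the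
     chord from [h 1] to [h n], so this chord exceeds [K]. *)
  have [|t t0 gt] := g_dist (A / (K + 1)); first by rewrite divr_gt0 ?ltr_wpDl.
  exists (Num.bound t^-1).+1 => n n_ge.
  rewrite complex_norm_Rcomplex ltcR.
  have := gt (x + (2%:R - 13) * d) (x + (n%:R - 13) * d) (x + (1%:R - 13) * d).
  rewrite (_ : x + _ - _ = d); last by ring.
  rewrite (_ : x + (n%:R - 13) * d - _ = (n%:R - 1) * d); last by ring.
  rewrite -/(h 2) -/(h 1) -/(h n) -/A [`|_ * d|]normrM [t * (_ * _)]mulrA => bnd.
  have {}bnd : A <= A / (K + 1) * `|h n - h 1 : Rcomplex R|.
    apply: bnd; rewrite ler_peMl // -ler_pdivrMl // mulr1.
    have n1 : (Num.bound t^-1)%:R + 1 <= n%:R :> R by rewrite natr1 ler_nat.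
    rewrite ger0_norm; last by rewrite subr_ge0; apply: le_trans n1; rewrite lerDr.
    rewrite lerBrDr; apply: le_trans n1; rewrite lerD2r ltW //.
    by rewrite archi_boundP // invr_ge0 ltW.
  move: bnd; rewrite -mulrA -ler_pdivrMl // mulVf ?gt_eqF // -ler_pdivrMl; last first.
    by rewrite invr_gt0 ltr_wpDl.
  by rewrite invrK mulr1; apply: lt_le_trans; rewrite ltrDl.
have := unbounded_equidistant_midpoint h_inj h_eq h_unb.
rewrite /h (_ : x + (25 - 13) * d = x + s); last by rewrite /d; field.
rewrite (_ : x + (13 - 13) * d = x); last by ring.
by rewrite (_ : x + (1 - 13) * d = x - s) //; rewrite /d; field.
Qed.

(** The midpoint equation makes [g] additive. The error [e] is then additive and zero on the
    integers, so reduction modulo 1 bounds it on the whole line; a bounded additive map vanishes. *)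
Lemma midpoint_bounded_linear g B : g 0 = 0 -> g 1 = 1 ->
  (forall x s, g (x + s) - g x = g x - g (x - s)) ->
  (forall x, 0 <= x <= 1 -> `|g x| <= B) ->
  forall x, g x = (x%:C)%C.
Proof.
move=> g0 g1 g_mid g_bnd.
have dbl x : g (x + x) = g x + g x.
  by have /eqP := g_mid x x; rewrite subrr g0 subr0 subr_eq => /eqP.
have add x y : g (x + y) = g x + g y.
  have := g_mid ((x + y) / 2) ((x - y) / 2).
  rewrite (_ : (x + y) / 2 + (x - y) / 2 = x); last by field.
  rewrite (_ : (x + y) / 2 - (x - y) / 2 = y); last by field.
  move=> /eqP; rewrite subr_eq addrAC eq_sym subr_eq -dbl => /eqP <-.
  by congr g; field.
pose e x := g x - (x%:C)%C : Rcomplex R.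
have e_add x y : e (x + y) = e x + e y.
  by rewrite /e add (rmorphD (@real_complex R)) opprD addrACA.
have e0 : e 0 = 0 by rewrite /e g0 subr0.
have e1 : e 1 = 0 by rewrite /e g1 subrr.
have eN x : e (- x) = - e x.
  by apply/eqP; rewrite -addr_eq0 -e_add addNr e0.
have eMn x n : e (x *+ n) = e x *+ n.
  by elim: n => [|n IH]; rewrite ?mulr0n // !mulrS e_add IH.
have e_int (m : int) : e m%:~R = 0.
  case: m => n; first by rewrite -pmulrn eMn e1 mul0rn.
  by rewrite NegzE rmorphN /= eN -pmulrn eMn e1 mul0rn oppr0.
have e_bnd x : `|e x| <= B + 1.
  rewrite -(subrKC (Num.floor x)%:~R x) e_add e_int add0r.
  set r := x - _.
  have /andP[r0 r1] : 0 <= r <= 1.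
    by rewrite subr_ge0 floor_le lerBlDl -intrD1 ltW // lt_succ_floor.
  rewrite (le_trans (ler_normB _ _)) // lerD ?g_bnd ?r0 //.
  by rewrite norm_real_Rcomplex ger0_norm.
move=> x; apply/eqP; rewrite -subr_eq0 -/(e x) -normr_eq0.
apply/negPn/negP => ex0; have ex_gt0 : 0 < `|e x| by rewrite lt_def ex0 /=.
pose n := Num.bound ((B + 1) / `|e x|).
have := e_bnd (x *+ n); rewrite eMn normrMn -mulr_natl -ler_pdivlMr // leNgt.
rewrite archi_boundP // divr_ge0 //.
exact: le_trans (normr_ge0 _) (e_bnd 0).
Qed.

End Distortion_bounds.

(** * Limits along an ultrafilter *)

Lemma ultra_fmap (S T : Type) (f : S -> T) (U : set_system S) :
  UltraFilter U -> UltraFilter (f @ U).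
Proof.
move=> UU; split=> [|G GP leG]; first exact: fmap_proper_filter.
apply/seteqP; split=> [A GA|]; last exact: leG.
have [//|UnA] := in_ultra_setVsetC (f @^-1` A) UU.
have /leG GnA : (f @ U) (~` A) by [].
by have [x [/= /[swap]/[apply]]] := filter_ex (filterI GA GnA).
Qed.

Section Componentwise_limits.
Variables (R : realType) (T : Type) (U : set_system T).
Context {UU : UltraFilter U}.
Implicit Types (z : T -> Rcomplex R) (w : Rcomplex R).

(** By compactness of the segment. A single ultrafilter serves all points at once, so no diagonal
    subsequence is extracted. *)
Lemma ultra_bounded_cvg (u : T -> R) B :
  (forall n, `|u n| <= B) -> exists l : R, u @ U --> l.
Proof.
move=> uB; have := @segment_compact R (- B) B; rewrite compact_ultra.
move=> /(_ (u @ U) (ultra_fmap _ _)) [|l [_ ul]]; last by exists l.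
by apply: (@filterS _ U) filterT => n _ /=; rewrite in_itv /= -ler_norml.
Qed.

Definition cvg_complex z w : Prop :=
  ((fun n => complex.Re (z n)) @ U --> complex.Re w) /\
  ((fun n => complex.Im (z n)) @ U --> complex.Im w).

Lemma cvg_complexB z1 z2 w1 w2 : cvg_complex z1 w1 -> cvg_complex z2 w2 ->
  cvg_complex (fun n => z1 n - z2 n) (w1 - w2).
Proof.
move=> [r1 i1] [r2 i2]; split.
  rewrite (_ : complex.Re (w1 - w2) = complex.Re w1 - complex.Re w2); last first.
    by case: w1 w2 {r1 i1 r2 i2} => ? ? [].
  rewrite (_ : (fun n => _) = (fun n => complex.Re (z1 n) - complex.Re (z2 n))).
    exact: cvgB.
  by apply/funext => n; case: (z1 n) (z2 n) => ? ? [].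
rewrite (_ : complex.Im (w1 - w2) = complex.Im w1 - complex.Im w2); last first.
  by case: w1 w2 {r1 i1 r2 i2} => ? ? [].
rewrite (_ : (fun n => _) = (fun n => complex.Im (z1 n) - complex.Im (z2 n))).
  exact: cvgB.
by apply/funext => n; case: (z1 n) (z2 n) => ? ? [].
Qed.

Lemma norm_Rcomplex_sqrt w :
  `|w| = Num.sqrt (complex.Re w ^+ 2 + complex.Im w ^+ 2) :> R.
Proof. by case: w. Qed.

Lemma cvg_complex_norm z w : cvg_complex z w ->
  (fun n => `|z n| : R) @ U --> (`|w| : R).
Proof.
move=> [r i]; rewrite norm_Rcomplex_sqrt.
under eq_fun do rewrite norm_Rcomplex_sqrt.
apply: (@continuous_cvg _ _ _ _ _ _ (@Num.sqrt R)); first exact: sqrt_continuous.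
by apply: cvgD; rewrite expr2; under eq_fun do rewrite expr2; apply: cvgM.
Qed.

End Componentwise_limits.

(** * Limits of rescaled maps *)

Section Blow_up.
Variables (R : realType) (G : nat -> R -> Rcomplex R).
Hypothesis G_bnd : forall t : R, 0 <= t ->
  exists c, forall n, distortion_le t c (G n).
Hypothesis G_small : forall c : R, 0 < c ->
  exists2 t, 0 < t & forall n, distortion_le t c (G n).
Hypothesis G_0 : forall n, G n 0 = 0.
Hypothesis G_1 : forall n, G n 1 = 1.
Hypothesis G_bal : forall x s e : R, 0 < e -> \forall n \near \oo,
  `|G n (x + s) - G n x| <= (1 + e) * `|G n (x - s) - G n x|.

(** Comparison with [G n 1 = 1] bounds each [G n x], so limits exist. The distortion bounds survive
    in the limit, and the approximate balance [G_bal] becomes exact. *)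
Lemma blow_up_cvg (U : set_system nat) (UU : UltraFilter U) :
  \oo `<=` U -> forall x, cvg_complex U (G^~ x) (x%:C)%C.
Proof.
move=> ooU.
have bnd x : exists B, forall n, `|G n x| <= B.
  have [c Gc] := G_bnd (normr_ge0 x); exists c => n.
  have := Gc n x 1 0; rewrite !subr0 normr1 mulr1 G_0 G_1 !subr0.
  by rewrite (norm_real_Rcomplex 1) normr1 mulr1; apply.
have lim x : exists w, cvg_complex U (G^~ x) w.
  have [B GB] := bnd x.
  have [|l rl] := @ultra_bounded_cvg R nat U _ (fun n => complex.Re (G n x)) B.
    move=> n; apply: le_trans (GB n); rewrite norm_Rcomplex_sqrt -sqrtr_sqr.
    by rewrite ler_wsqrtr // lerDl sqr_ge0.
  have [|l' il] := @ultra_bounded_cvg R nat U _ (fun n => complex.Im (G n x)) B.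
    move=> n; apply: le_trans (GB n); rewrite norm_Rcomplex_sqrt -sqrtr_sqr.
    by rewrite ler_wsqrtr // lerDr sqr_ge0.
  by exists (l +i* l')%C; split.
pose g x : Rcomplex R := projT1 (cid (lim x)).
have g_lim x : cvg_complex U (G^~ x) (g x) by exact: projT2 (cid (lim x)).
have dist_lim x y : (fun n => `|G n x - G n y| : R) @ U --> (`|g x - g y| : R).
  exact: cvg_complex_norm (cvg_complexB (g_lim x) (g_lim y)).
have g_dist t c : (forall n, distortion_le t c (G n)) -> distortion_le t c g.
  move=> Gd a b x abx.
  apply: (ler_cvg_to (dist_lim a x)).
    by apply: cvgM; [exact: cvg_cst|exact: dist_lim].
  by apply: (@filterS _ U) filterT => n _; exact: Gd.
have g_const x z : (forall n, G n x = z) -> g x = z.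
  move=> Gz; have := g_lim x; rewrite (_ : G^~ x = fun=> z); last exact/funext.
  case=> r i.
  have er : complex.Re (g x) = complex.Re z by exact: (cvg_unique _ r (cvg_cst _)).
  have ei : complex.Im (g x) = complex.Im z by exact: (cvg_unique _ i (cvg_cst _)).
  by case: (g x) z er ei {Gz r i} => ? ? [? ?] /= -> ->.
have g0 : g 0 = 0 by exact: g_const.
have g1 : g 1 = 1 by exact: g_const.
have g_inj : injective g.
  move=> a b gab; apply/eqP; apply: contraT => ab.
  (* If [g a = g b], the distortion bound centred at [a] collapses every value onto [g a],
     contradicting [g 0 <> g 1]. *)
  have all_a y : g y = g a.
    have [|c Gc] := @G_bnd (`|y - a| / `|b - a|); first by rewrite divr_ge0.
    have := g_dist _ _ Gc y b a.
    rewrite divfK ?normr_eq0 ?subr_eq0 1?eq_sym // => /(_ (lexx _)).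
    by rewrite gab subrr normr0 mulr0 normr_le0 subr_eq0 => /eqP.
  by have := oner_neq0 R[i]; rewrite -[1]g1 -[0]g0 !all_a eqxx.
have g_le x s : `|g (x + s) - g x| <= `|g (x - s) - g x|.
  apply/ler_addgt0Pr => e e0; set B := `|g (x - s) - g x|.
  have B0 : 0 <= B by exact: normr_ge0.
  have B1 : 0 < B + 1 by rewrite ltr_wpDl.
  (* Dividing by [B + 1] keeps the error below [e] and is safe when [B = 0]. *)
  apply: (@le_trans _ _ ((1 + e / (B + 1)) * B)).
    apply: (ler_cvg_to (dist_lim (x + s) x)).
      by apply: cvgM; [exact: cvg_cst|exact: dist_lim].
    by apply: ooU; apply: G_bal; exact: divr_gt0.
  rewrite mulrDl mul1r lerD2l mulrAC ler_pdivrMr //.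
  by rewrite ler_wpM2l ?lerDl // ltW.
have g_bal : balanced g.
  move=> x s; apply/le_anti; rewrite g_le /=.
  by have := g_le x (- s); rewrite opprK.
have g_mid : forall x s, g (x + s) - g x = g x - g (x - s).
  apply: balanced_midpoint => // c c0.
  by have [t t0 Gt] := G_small c0; exists t => //; exact: g_dist.
have [c Gc] := G_bnd ler01.
move=> x; rewrite -(@midpoint_bounded_linear R g c g0 g1 g_mid) // => y /andP[y0 y1].
have := g_dist _ _ Gc y 1 0.
rewrite !subr0 normr1 mulr1 g0 g1 !subr0 (norm_real_Rcomplex 1) normr1 mulr1.
by apply; rewrite ger0_norm.
Qed.

(** Convergence is only pointwise while [tau n] moves. [G_small], centred at the limit [l] of [tau],
    supplies the missing equicontinuity. *)
Lemma blow_up_bound (tau : nat -> R) (t rho : R) :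
  (forall n, `|tau n| <= t) -> t < rho -> exists n, `|G n (tau n)| < rho.
Proof.
move=> tau_le t_rho.
have [U [UU ooU]] := @ultraFilterLemma nat \oo _.
have [l taul] := ultra_bounded_cvg tau_le.
have lt : `|l| <= t.
  apply: (ler_cvg_to (cvg_norm taul) (cvg_cst t)).
  by apply: (@filterS _ U) filterT => n _; exact: tau_le.
have dist_lim x y : (fun n => `|G n x - G n y| : R) @ U --> (`|x - y| : R).
  rewrite -norm_real_Rcomplex (rmorphB (@real_complex R)).
  have lim := blow_up_cvg UU ooU.
  exact: cvg_complex_norm (cvg_complexB (lim x) (lim y)).
pose d := rho - t; have d0 : 0 < d by rewrite subr_gt0.
(* The chord from [l] to [l + 1] has image shorter than 2, so replacing [l] by [tau n] costs at most
   [d / 2]; the other [d / 2] is spent on [G n l]. *)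
have [e e0 Ge] := @G_small (d / 4) ltac:(by rewrite divr_gt0).
have near1 : \forall n \near U, `|G n l - G n 0| < t + d / 2.
  apply: (cvgr_lt _ (dist_lim l 0)).
  by rewrite subr0 (le_lt_trans lt) // ltrDl divr_gt0.
have near2 : \forall n \near U, `|G n (l + 1) - G n l| < 2.
  apply: (cvgr_lt _ (dist_lim (l + 1) l)).
  by rewrite addrAC subrr add0r normr1 ltr1n.
have near3 : \forall n \near U, `|l - tau n| <= e.
  exact: (cvgr_dist_le _ _ taul).
have [n [[n1 n2] n3]] := filter_ex (filterI (filterI near1 near2) near3).
exists n; rewrite -(subrK (G n l) (G n (tau n))).
apply: (le_lt_trans (ler_normD _ _)).
have := Ge n (tau n) (l + 1) l.
rewrite addrAC subrr add0r normr1 mulr1 distrC => /(_ n3) n4.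
rewrite G_0 subr0 in n1.
have n5 : `|G n (tau n) - G n l| <= d / 4 * 2.
  by apply: (le_trans n4); rewrite ler_wpM2l ?divr_ge0 ?(ltW d0) // ltW.
apply: (lt_le_trans (ler_ltD n5 n1)).
by rewrite /d; lra.
Qed.

End Blow_up.

(** * Diameters of triples *)

Section Diameter.
Variables (R : realType) (X : metricType R).
Implicit Types a b x : X.

Lemma mdist_le_diam (A : set X) a b (r : R) :
  (diam A <= r%:E)%E -> A a -> A b -> mdist a b <= r.
Proof.
move=> dA Aa Ab; rewrite -lee_fin; apply: le_trans dA.
by apply: ereal_sup_ubound; exists (a, b).
Qed.

Lemma diam_le (A : set X) (r : R) :
  (forall a b, A a -> A b -> mdist a b <= r) -> (diam A <= r%:E)%E.
Proof.
by move=> Ar; apply: ub_ereal_sup => _ [[a b] [Aa Ab] <-]; rewrite lee_fin Ar.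
Qed.

Lemma diam_triple_le a b x (r : R) : mdist a x <= r -> mdist b x <= r ->
  (diam [set a; b; x] <= (r + r)%:E)%E.
Proof.
move=> ax bx.
have cx c : [set a; b; x] c -> mdist c x <= r.
  move=> [[]|] -> //; rewrite mdistxx; exact: le_trans (mdist_ge0 a x) ax.
apply: diam_le => c d /cx c_le /cx d_le.
by apply: le_trans (metric_triangle c x d) _; rewrite lerD // metric_sym.
Qed.

Lemma diam_triple_gt0 a b x : b != x -> (0 < diam [set a; b; x])%E.
Proof.
move=> bx; apply: (@lt_le_trans _ _ (mdist b x)%:E).
  by rewrite lte_fin mdist_gt0.
by apply: ereal_sup_ubound; exists (b, x) => //=; split; [left; right|right].
Qed.

End Diameter.

(** * Quasisymmetric embeddings of the line *)

Section Quasisymmetric.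
Variables (R : realType) (f : R^o -> Rcomplex R).
Hypothesis f_qs : quasisymmetric f.

Lemma quasisymmetric_inj : injective f.
Proof.
have [[g [[_ finj _] _ _ _]] _] := f_qs.
by move=> a b; apply: finj; rewrite in_setT.
Qed.

Let mdistRE (a b : R^o) : mdist a b = `|a - b|.
Proof. exact: distrC. Qed.

(* Unqualified, [ratio] is the one of [fraction]. *)
Lemma ratioE (a b x : R^o) : Defs.ratio f a b x = `|f a - f x| / `|f b - f x|.
Proof. by []. Qed.

Lemma quasisymmetric_distortion_bound (t : R) : 0 <= t ->
  exists c, distortion_le t c f.
Proof.
have [_ [eta [_ f_eta]]] := f_qs.
(* [eta t] handles distinct triples; the maximum with 1 handles [a = b]. *)
move=> t0; exists (Num.max 1 (eta t)) => a b x abx.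
have c0 : 0 <= Num.max 1 (eta t) by rewrite le_max ler01.
have [ax|ax] := eqVneq a x; first by rewrite ax subrr normr0 mulr_ge0.
have bx : b != x.
  by apply: contraNneq ax => bx; move: abx; rewrite bx subrr normr0 mulr0
    normr_le0 subr_eq0.
have [->|ab] := eqVneq a b; first by rewrite ler_peMl // le_max lexx.
rewrite -ler_pdivrMr; last by rewrite normr_gt0 subr_eq0 (inj_eq quasisymmetric_inj).
rewrite -ratioE le_max f_eta ?orbT // !mdistRE ler_pdivrMr //.
by rewrite normr_gt0 subr_eq0.
Qed.

Lemma quasisymmetric_distortion_small (c : R) : 0 < c ->
  exists2 t, 0 < t & distortion_le t c f.
Proof.
have [_ [eta [[g [[_ _ eta_surj] _ _ _]] f_eta]]] := f_qs.
move=> c0.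
(* Preimages of [c] and [c / 2] under [eta] differ, so one of them is positive. *)
have [u u0 eta_u] : exists2 u, 0 < u & eta u <= c.
  have [|v v0 ev] := eta_surj c; first by rewrite /= in_itv /= ltW.
  have [|w w0 ew] := eta_surj (c / 2); first by rewrite /= in_itv /= divr_ge0 ?ltW.
  move: v0 w0; rewrite /= !in_itv /= !andbT => v0 w0.
  have [v_eq0|v_neq0] := eqVneq v 0; last by exists v; rewrite ?lt_def ?v_neq0 ?ev.
  exists w; last by rewrite ew ler_pdivrMr // ler_peMr ?ltW // ltr1n.
  rewrite lt_def w0 andbT; apply/eqP => w_eq0.
  by move: ew; rewrite w_eq0 -v_eq0 ev; lra.
(* The bound 1/2 rules out [a = b]. *)
exists (Num.min u 2^-1); first by rewrite lt_min u0 invr_gt0 /=.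
move=> a b x abx.
have [ax|ax] := eqVneq a x; first by rewrite ax subrr normr0 mulr_ge0 // ltW.
have bx : b != x.
  by apply: contraNneq ax => bx; move: abx; rewrite bx subrr normr0 mulr0
    normr_le0 subr_eq0.
have bx0 : 0 < `|b - x| by rewrite normr_gt0 subr_eq0.
have ab : a != b.
  apply/eqP => ab; move: abx; rewrite ab; apply/negP; rewrite -ltNge.
  by rewrite gtr_pMl // gt_min invf_lt1 ?ltr1n ?orbT.
rewrite -ler_pdivrMr; last by rewrite normr_gt0 subr_eq0 (inj_eq quasisymmetric_inj).
rewrite -ratioE; apply: le_trans eta_u; apply: f_eta => //; first exact: ltW.
rewrite !mdistRE ler_pdivrMr //; apply: le_trans abx _.
by rewrite ler_wpM2r // ge_min lexx.
Qed.


Lemma Heq_ge1 (r : R) : 0 < r -> (1 <= Heq f r)%E.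
Proof.
(* [Heq] admits triples with [a = b], whose ratio is 1. *)
move=> r0; apply: ereal_sup_ubound; exists (r / 2), (r / 2), 0.
have r2 : 0 < r / 2 by rewrite divr_gt0.
split => //.
  apply/andP; split; first by apply: diam_triple_gt0; rewrite gt_eqF.
  have le2 : mdist (r / 2 : R^o) 0 <= r / 2 by rewrite mdistRE subr0 gtr0_norm.
  by rewrite [r in leRHS]splitr diam_triple_le.
by rewrite ratioE divff ?maxxx // normr_eq0 subr_eq0 (inj_eq quasisymmetric_inj) gt_eqF.
Qed.

Lemma weakly_asymptotically_symmetric_equidistant :
  weakly_asymptotically_symmetric f ->
  equidistant_weakly_asymptotically_symmetric f.
Proof.
move=> f_was.
have Heq_near (e : R) : 0 < e ->
    \forall r \near 0^'+, (1 <= Heq f r <= (1 + e)%:E)%E.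
  move=> e0; have [d d0 fd] := f_was e e0.
  near=> r; rewrite Heq_ge1 //=.
  have r_le : r <= d by near: r; exact: nbhs_right_le.
  have ratio_le (a b x : R^o) : mdist a x = mdist b x ->
      (0 < diam [set a; b; x] <= r%:E)%E -> Defs.ratio f a b x <= 1 + e.
    move=> abx /andP[diam0 diam_r].
    have [ab|ab] := eqVneq a b.
      rewrite ab ratioE; have [->|nz] := eqVneq `|f b - f x| 0.
        by rewrite mul0r addr_ge0 // ltW.
      by rewrite divff // lerDl ltW.
    have ax : a != x.
      apply: contraNneq ab => ax; move: abx; rewrite ax mdistxx.
      by move=> /esym /mdist_positivity ->.
    have bx : b != x.
      apply: contraNneq ab => bx; move: abx; rewrite bx mdistxx.
      by move=> /mdist_positivity ->.
    rewrite -[1 + e]mulr1; apply: fd => //.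
      by apply: le_trans diam_r _; rewrite lee_fin.
    by rewrite abx divff // gt_eqF // mdist_gt0.
  apply: ub_ereal_sup => _ [a [b [x [abx diam_abx ->]]]].
  rewrite lee_fin ge_max !ratio_le //.
  by rewrite [[set b; a]]setUC.
apply/fine_cvgP; split.
  near=> r; have /andP[ge1 le2] : (1 <= Heq f r <= (1 + 1)%:E)%E.
    by near: r; exact: Heq_near ltr01.
  by rewrite fin_numE; case: (Heq f r) ge1 le2.
apply/cvgrPdist_le => e e0; near=> r.
have : (1 <= Heq f r <= (1 + e)%:E)%E by near: r; exact: Heq_near.
rewrite /=; case: (Heq f r) => [y| |//]; last by rewrite leye_eq andbF.
by rewrite !lee_fin => /andP[y1 ye]; rewrite distrC ger0_norm ?subr_ge0 // lerBlDl.
Unshelve. all: by end_near. Qed.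

Lemma equidistant_weakly_asymptotically_symmetricP :
  equidistant_weakly_asymptotically_symmetric f ->
  forall e : R, 0 < e -> exists2 d, 0 < d & forall x s : R, `|s| <= d ->
    `|f (x + s) - f x| <= (1 + e) * `|f (x - s) - f x|.
Proof.
move=> /fine_cvgP[Heq_fin Heq_cvg] e e0.
have /cvgrPdist_le/(_ e e0) Heq_dist := Heq_cvg.
have [r [[Heq_r fin_r] r0]] :=
  @filter_ex _ _ (at_right_proper_filter (0 : R)) _
    (filterI (filterI Heq_dist Heq_fin) (nbhs_right_gt (0 : R))).
(* The triple [x + s], [x - s], [x] has diameter at most twice [|s|]. *)
exists (r / 2); first by rewrite divr_gt0.
move=> x s s_le; have [->|s0] := eqVneq s 0.
  by rewrite addr0 subr0 subrr normr0 mulr0.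
have xs0 : x - s != x by rewrite -subr_eq0 addrAC subrr add0r oppr_eq0.
rewrite -ler_pdivrMr; last by rewrite normr_gt0 subr_eq0 (inj_eq quasisymmetric_inj).
rewrite -(ratioE (x + s) (x - s) x) -lee_fin.
have dist_p : mdist (x + s : R^o) x = `|s| by rewrite mdistRE addrAC subrr add0r.
have dist_m : mdist (x - s : R^o) x = `|s|.
  by rewrite mdistRE addrAC subrr add0r normrN.
apply: (@le_trans _ _ (Heq f r)); last first.
  rewrite -(fineK fin_r) lee_fin.
  by move: Heq_r; rewrite /= distrC ler_norml => /andP[_]; rewrite lerBlDl.
apply: (@le_trans _ _ (Num.max (Defs.ratio f (x + s) (x - s) x)
                               (Defs.ratio f (x - s) (x + s) x))%:E).
  by rewrite lee_fin le_max lexx.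
apply: ereal_sup_ubound; exists (x + s), (x - s), x; split => //.
  by rewrite dist_p dist_m.
rewrite diam_triple_gt0 //= [r in leRHS]splitr diam_triple_le //.
  by rewrite dist_p.
by rewrite dist_m.
Qed.


Lemma equidistant_asymptotically_symmetric :
  equidistant_weakly_asymptotically_symmetric f -> asymptotically_symmetric f.
Proof.
move=> f_ewas t t0 eps eps0.
have f_bal := equidistant_weakly_asymptotically_symmetricP f_ewas.
apply: contrapT => no_delta.
have bad n : exists abx : R * R * R, let: (a, b, x) := abx in
    [/\ b != x, `|b - x| <= n.+1%:R^-1, `|a - x| <= t * `|b - x| &
        (1 + eps) * t < `|f a - f x| / `|f b - f x|].
  apply: contrapT => good; apply: no_delta; exists n.+1%:R^-1.
    by rewrite invr_gt0 ltr0n.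
  move=> a b x ab ax bx diam_abx abx; rewrite leNgt; apply/negP => ratio_gt.
  apply: good; exists (a, b, x); split => //.
    by rewrite -mdistRE; apply: mdist_le_diam diam_abx _ _; [left; right|right].
  by rewrite -ler_pdivrMr -?mdistRE // mdist_gt0.
pose p n := projT1 (cid (bad n)).
pose a n := (p n).1.1; pose b n := (p n).1.2; pose x n := (p n).2.
have pP n : [/\ b n != x n, `|b n - x n| <= n.+1%:R^-1,
    `|a n - x n| <= t * `|b n - x n| &
    (1 + eps) * t < `|f (a n) - f (x n)| / `|f (b n) - f (x n)|].
  by rewrite /a /b /x /p; case: cid => -[[a' b'] x'].
pose l n := b n - x n.
have l0 n : l n != 0 by rewrite subr_eq0; have [] := pP n.
pose w n : Rcomplex R := f (b n) - f (x n).
have w0 n : w n != 0.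
  by rewrite subr_eq0 (inj_eq quasisymmetric_inj); have [] := pP n.
(* Affine maps in source and target send [x n] to 0, [b n] to 1 and their images likewise. The point
   [a n] goes to [tau n], and [|G n (tau n)|] is the offending ratio. *)
pose G n s : Rcomplex R := (f (x n + s * l n) - f (x n)) / w n.
have GB n s1 s2 :
    `|G n s1 - G n s2| = `|f (x n + s1 * l n) - f (x n + s2 * l n)| / `|w n|.
  by rewrite -mulrBl norm_RcomplexM norm_RcomplexV opprB addrA subrK.
have G_dist c s n : distortion_le s c f -> distortion_le s c (G n).
  move=> f_dist u v y uvy; rewrite !GB mulrA ler_wpM2r ?invr_ge0 //.
  apply: f_dist; rewrite !opprD ![_ + (- x n - _)]addrACA subrr !add0r -!mulrBl.
  by rewrite !normrM mulrA ler_wpM2r.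
have G0 n : G n 0 = 0 by rewrite /G mul0r addr0 subrr mul0r.
have G1 n : G n 1 = 1 by rewrite /G /l mul1r subrKC; apply: divff (w0 n).
pose tau n := (a n - x n) / l n.
have tau_le n : `|tau n| <= t.
  by rewrite normf_div ler_pdivrMr ?normr_gt0 //; have [] := pP n.
have G_bnd s : 0 <= s -> exists c, forall n, distortion_le s c (G n).
  move=> /quasisymmetric_distortion_bound[c fc].
  by exists c => n; exact: G_dist.
have G_small c : 0 < c -> exists2 s, 0 < s & forall n, distortion_le s c (G n).
  move=> /quasisymmetric_distortion_small[s s0 fs].
  by exists s => // n; exact: G_dist.
have G_bal y s e : 0 < e -> \forall n \near \oo,
    `|G n (y + s) - G n y| <= (1 + e) * `|G n (y - s) - G n y|.
  move=> /f_bal[d d0 fd].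
  near=> n.
  rewrite !GB mulrA ler_wpM2r ?invr_ge0 // mulrDl mulrBl !addrA; apply: fd.
  (* In the original scale the step [s] has length at most [|s| / (n + 1)], eventually below [d]. *)
  rewrite normrM; have [_ ln _ _] := pP n.
  apply: (le_trans (ler_wpM2l _ ln)) => //.
  rewrite ler_pdivrMr // -ler_pdivrMl //.
  apply: (@le_trans _ _ n%:R); last by rewrite ler_nat.
  by near: n; exact: nbhs_infty_ger.
have [|n] := blow_up_bound G_bnd G_small G0 G1 G_bal tau_le (rho := (1 + eps) * t).
  by rewrite ltr_pMl // ltrDl.
rewrite /G divfK // subrKC norm_RcomplexM norm_RcomplexV.
by have [_ _ _ /lt_trans /[apply]] := pP n; rewrite ltxx.
Unshelve. all: by end_near. Qed.

End Quasisymmetric.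

Theorem theorem1p1 (R : realType) (f : R^o -> Rcomplex R)
  (f_qs : quasisymmetric f) :
  (asymptotically_symmetric f <-> weakly_asymptotically_symmetric f) /\
  (weakly_asymptotically_symmetric f <->
     equidistant_weakly_asymptotically_symmetric f).
Proof.
have as_was : asymptotically_symmetric f -> weakly_asymptotically_symmetric f.
  by move=> /(_ 1 ltr01).
have was_ewas := weakly_asymptotically_symmetric_equidistant f_qs.
have ewas_as := equidistant_asymptotically_symmetric f_qs.
by split; split => //; [move=> /was_ewas/ewas_as|move=> /ewas_as/as_was].
Qed.
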